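(* The identity of formal power series in $T$ $$1+(z^2-1)(1-w^2)\,\frac{\sum_{\lambda}\mathcal{H}_\lambda(z,w)\,\phi_\lambda(z^2,w^2)\,T^{|\lambda|}}{\sum_{\lambda}\mathcal{H}_\lambda(z,w)\,T^{|\lambda|}}=\prod_{n\ge1}\frac{(1-zwT^n)^2}{(1-z^2T^n)(1-w^2T^n)},$$ where the sums run over all partitions $\lambda$ (including the empty one), is true in the specialization $(z,w)\mapsto(1/\sqrt{q},\sqrt{q})$.
   Context: For a partition $\lambda$ (here in genus $g=1$), $$\mathcal{H}_\lambda(z,w)=\prod_{\text{boxes of }\lambda}\frac{(z^{2a+1}-w^{2l+1})^{2}}{(z^{2a+2}-w^{2l})(z^{2a}-w^{2l+2})},$$ where $a$ and $l$ are the arm length and leg length of the box (so $\mathcal{H}_\emptyset=1$). For a non-empty partition $\lambda$, $\phi_\lambda(z,w)=\sum_{(i,j)\in\lambda}z^{j-1}w^{i-1}$, the sum running over the boxes of $\lambda$ ($i$ the row index and $j$ the column index), and $\phi_\emptyset=0$. $|\lambda|$ is the size of $\lambda$. Here $q$ is an indeterminate, and the specialized identity is an identity of formal power series in $T$ whose coefficients are rational functions of $\sqrt q$. *)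

(* Defs.v *)
From HB Require Import structures.
From mathcomp Require Import all_boot all_order all_algebra.
From mathcomp Require Import boolp.

Set Implicit Arguments.
Unset Strict Implicit.
Unset Printing Implicit Defensive.

Import Order.TTheory GRing.Theory Num.Theory.
Local Open Scope ring_scope.

Record fps (K : Type) := Fps { fps_coef :> nat -> K }.

HB.instance Definition _ (K : Type) := gen_eqMixin (fps K).
HB.instance Definition _ (K : Type) := gen_choiceMixin (fps K).

Lemma fpsP (K : Type) (f g : fps K) : (forall n, f n = g n) -> f = g.
Proof. by case: f => f; case: g => g /= fg; congr Fps; apply/funext. Qed.

Section FpsRing.
Variable K : fieldType.
Implicit Types (f g h : fps K) (c : K) (n : nat).

Definition fps_const c : fps K := Fps (fun n => if n == 0%N then c else 0).
Definition fpsX : fps K := Fps (fun n => (n == 1%N)%:R).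
Definition fps_add f g : fps K := Fps (fun n => f n + g n).
Definition fps_opp f : fps K := Fps (fun n => - f n).
Definition fps_mul f g : fps K := Fps (fun n => \sum_(i < n.+1) f i * g (n - i)%N).

Lemma fps_addA : associative fps_add.
Proof. by move=> f g h; apply: fpsP => n /=; rewrite addrA. Qed.
Lemma fps_addC : commutative fps_add.
Proof. by move=> f g; apply: fpsP => n /=; rewrite addrC. Qed.
Lemma fps_add0 : left_id (fps_const 0) fps_add.
Proof. by move=> f; apply: fpsP => n /=; rewrite if_same add0r. Qed.
Lemma fps_addN : left_inverse (fps_const 0) fps_opp fps_add.
Proof. by move=> f; apply: fpsP => n /=; rewrite if_same addNr. Qed.

HB.instance Definition _ :=
  GRing.isZmodule.Build (fps K) fps_addA fps_addC fps_add0 fps_addN.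

Definition fps_trunc n f : {poly K} := \poly_(i < n) f i.

Lemma coef_fps_trunc n f i : (i < n)%N -> (fps_trunc n f)`_i = f i.
Proof. by move=> lt_in; rewrite coef_poly lt_in. Qed.

Lemma fps_mul_trunc N f g n : (n < N)%N ->
  fps_mul f g n = (fps_trunc N f * fps_trunc N g)`_n.
Proof.
move=> ltnN; rewrite coefM /=; apply: eq_bigr => i _.
rewrite !coef_fps_trunc //; last exact: leq_ltn_trans (leq_ord i) ltnN.
exact: leq_ltn_trans (leq_subr _ _) ltnN.
Qed.

Lemma fps_mulC : commutative fps_mul.
Proof.
by move=> f g; apply: fpsP => n; rewrite !(@fps_mul_trunc n.+1) // mulrC.
Qed.

Lemma fps_mulA : associative fps_mul.
Proof.
move=> f g h; apply: fpsP => n.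
pose t := fps_trunc n.+1.
have -> : fps_mul f (fps_mul g h) n = (t f * (t g * t h))`_n.
  rewrite coefM; apply: eq_bigr => i _.
  rewrite coef_fps_trunc // (@fps_mul_trunc n.+1) //.
  by rewrite ltnS leq_subr.
have -> : fps_mul (fps_mul f g) h n = (t f * t g * t h)`_n.
  rewrite coefM; apply: eq_bigr => i _.
  by rewrite [in RHS]coef_fps_trunc ?ltnS ?leq_subr // (@fps_mul_trunc n.+1).
by rewrite mulrA.
Qed.

Lemma fps_mul1 : left_id (fps_const 1) fps_mul.
Proof.
move=> f; apply: fpsP => n /=.
by rewrite big_ord_recl /= mul1r subn0 big1 ?addr0 // => i _; rewrite mul0r.
Qed.

Lemma fps_mulDl : left_distributive fps_mul fps_add.
Proof.
move=> f g h; apply: fpsP => n /=.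
by rewrite -big_split; apply: eq_bigr => i _; rewrite mulrDl.
Qed.

Lemma fps_1neq0 : fps_const 1 != 0 :> fps K.
Proof.
apply/eqP => /(congr1 (fun f : fps K => f 0%N)) /= /eqP.
by rewrite oner_eq0.
Qed.

HB.instance Definition _ := GRing.Zmodule_isComNzRing.Build (fps K)
  fps_mulA fps_mulC fps_mul1 fps_mulDl fps_1neq0.

Fixpoint fps_inv_seq f n : seq K :=
  if n is m.+1 then
    let s := fps_inv_seq f m in
    rcons s (((m == 0%N)%:R - \sum_(i < m) f (m - i)%N * s`_i) / f 0%N)
  else [::].

(* A series with zero constant term is not a unit; as for every MathComp
   unitRingType, it is then its own (meaningless) inverse. *)
Definition fps_unit : pred (fps K) := fun f => f 0%N != 0.
Definition fps_inv f : fps K :=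
  if fps_unit f then Fps (fun n => (fps_inv_seq f n.+1)`_n) else f.

Lemma size_fps_inv_seq f n : size (fps_inv_seq f n) = n.
Proof. by elim: n => //= n IHn; rewrite size_rcons IHn. Qed.

Lemma nth_fps_inv_seq f n m : (m < n)%N ->
  (fps_inv_seq f n)`_m = (fps_inv_seq f m.+1)`_m.
Proof.
elim: n => // n IHn; rewrite ltnS leq_eqVlt => /predU1P[-> //|lt_mn].
by rewrite -IHn // [LHS]/= nth_rcons size_fps_inv_seq lt_mn.
Qed.

Lemma fps_mulV : {in fps_unit, left_inverse 1 fps_inv *%R}.
Proof.
move=> f uf; rewrite /fps_inv [fps_unit f]uf; apply: fpsP => n.
pose g m := (fps_inv_seq f m.+1)`_m.
have gE : g n = ((n == 0%N)%:R - \sum_(i < n) g i * f (n - i)%N) / f 0%N.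
  rewrite /g /= nth_rcons size_fps_inv_seq ltnn eqxx.
  congr ((_ - _) / _); apply: eq_bigr => i _.
  by rewrite nth_fps_inv_seq ?ltn_ord // mulrC.
change (\sum_(i < n.+1) g i * f (n - i)%N = if n == 0%N then 1 else 0).
move: g gE => g gE; rewrite big_ord_recr /= subnn gE divfK //.
by rewrite addrC subrK; case: (n == 0%N).
Qed.

Lemma fps_unitP f g : g * f = 1 -> fps_unit f.
Proof.
move/(congr1 (fun h : fps K => h 0%N)) => /=.
rewrite big_ord_recl big_ord0 addr0 subn0 => gf1.
by apply: contra_eq_neq gf1 => ->; rewrite mulr0 eq_sym oner_eq0.
Qed.

Lemma fps_inv_out : {in [predC fps_unit], fps_inv =1 id}.
Proof. by move=> f nuf; rewrite /fps_inv ifN. Qed.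

HB.instance Definition _ := GRing.ComNzRing_hasMulInverse.Build (fps K)
  fps_mulV fps_unitP fps_inv_out.

(* [P] is the infinite product of the [F n], n >= 1, for the T-adic topology:
   every coefficient of the partial products is eventually that of [P]. *)
Definition fps_is_prod (F : nat -> fps K) (P : fps K) : Prop :=
  forall m, exists N0, forall N, (N0 <= N)%N ->
    (\prod_(1 <= n < N.+1) F n) m = P m.

End FpsRing.

Arguments fpsX {K}.

(* A partition is the weakly decreasing list of its (positive) parts. *)
Definition is_partition (la : seq nat) : bool :=
  sorted geq la && (0%N \notin la).

(* A partition of n has at most n parts, each at most n, whence the finite type
   that is filtered here; see [mem_partitions]. *)
Definition partitions (n : nat) : seq (seq nat) :=
  [seq la <- [seq map val (s : seq 'I_n.+1) | s : n.-bseq 'I_n.+1]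
     | is_partition la & sumn la == n].

Lemma partitions_uniq n : uniq (partitions n).
Proof.
rewrite filter_uniq // map_inj_uniq ?enum_uniq //.
by move=> s t /(inj_map val_inj) /val_inj.
Qed.

Lemma mem_partitions n la :
  (la \in partitions n) = is_partition la && (sumn la == n).
Proof.
rewrite mem_filter; apply: andb_idr => /andP[/andP[_ la_gt0] /eqP sum_la].
have size_la : (size la <= n)%N.
  rewrite -sum_la; elim: la la_gt0 {sum_la} => //= x la IHla.
  rewrite inE negb_or eq_sym -lt0n => /andP[x_gt0 /IHla le_la].
  by rewrite -add1n leq_add.
have le_la x : x \in la -> (x < n.+1)%N.
  rewrite ltnS -sum_la; elim: la {la_gt0 sum_la size_la} => //= y la IHla.
  rewrite inE => /predU1P[->|/IHla le_x]; first exact: leq_addr.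
  exact: leq_trans le_x (leq_addl _ _).
pose s : seq 'I_n.+1 := map inord la.
have size_s : (size s <= n)%N by rewrite size_map.
apply/mapP; exists (Bseq size_s); first exact: mem_enum.
rewrite /= -map_comp -[LHS]map_id; apply/eq_in_map => x /le_la lt_xn /=.
by rewrite inordK.
Qed.

(* Boxes (i, j), with row i < size la and column j < la_i, are numbered from 0.
   The arm of a box counts the boxes to its right in its row, the leg those
   below it in its column (column j has [count (fun r => j < r) la] boxes). *)
Definition arm (la : seq nat) (i j : nat) : nat := (nth 0 la i - j).-1.
Definition leg (la : seq nat) (i j : nat) : nat :=
  (count (fun r => j < r)%N la - i).-1.

Section HookFunctions.
Variable K : fieldType.
Implicit Types (la : seq nat) (z w x y : K).

Definition hook_term z w (a l : nat) : K :=
  (z ^+ (2 * a + 1) - w ^+ (2 * l + 1)) ^+ 2 /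
  ((z ^+ (2 * a + 2) - w ^+ (2 * l)) * (z ^+ (2 * a) - w ^+ (2 * l + 2))).

Definition Hook z w la : K :=
  \prod_(i < size la) \prod_(j < nth 0%N la i)
    hook_term z w (arm la i j) (leg la i j).

(* The exponents j - 1 and i - 1 of 1-based indices are j and i here. *)
Definition phi x y la : K :=
  \sum_(i < size la) \sum_(j < nth 0%N la i) x ^+ j * y ^+ i.

Definition partition_series (c : seq nat -> K) : fps K :=
  Fps (fun n => \sum_(la <- partitions n) c la).

Lemma partition_series_Hook_unit z w :
  partition_series (Hook z w) \is a GRing.unit.
Proof.
have parts0 : partitions 0 = [:: [::]].
  apply: perm_small_eq => //; apply: uniq_perm; rewrite ?partitions_uniq //.
  move=> la; rewrite mem_partitions inE.
  apply/andP/eqP => [[]|->] //; case: la => [|x la] // /andP[_].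
  by rewrite inE /= addn_eq0 negb_or eq_sym => /andP[/negPf-> _].
change (partition_series (Hook z w) 0%N != 0).
by rewrite /= parts0 big_seq1 /Hook big_ord0 oner_eq0.
Qed.

End HookFunctions.

(* The indeterminate of the rational function field is sqrt q, so that
   q = sqrtq ^+ 2. *)
Definition Qsqrtq : fieldType := {fraction {poly rat}}.
Definition sqrtq : Qsqrtq := FracField.tofrac ('X : {poly rat}).

Lemma sqrtq_neq0 : sqrtq != 0.
Proof. by rewrite tofrac_eq0 polyX_eq0. Qed.

Lemma sqrtqX_neq1 n : (0 < n)%N -> sqrtq ^+ n != 1.
Proof.
move=> n_gt0; rewrite -tofracXn -tofrac1 tofrac_eq -subr_eq0.
by rewrite -size_poly_gt0 size_XnsubC.
Qed.

Lemma sqrtqV_expB_neq0 m n : (0 < m + n)%N -> sqrtq^-1 ^+ m - sqrtq ^+ n != 0.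
Proof.
move=> mn_gt0; rewrite subr_eq0 exprVn.
apply: contra_neq (sqrtqX_neq1 mn_gt0) => eq_mn.
by rewrite exprD -eq_mn mulfV // expf_neq0 // sqrtq_neq0.
Qed.

(* No denominator of [Hook] vanishes at (z, w) = (1 / sqrt q, sqrt q), so the
   specialization of these rational functions is plain substitution. *)
Lemma hook_denominator_neq0 (a l : nat) (z := sqrtq^-1) (w := sqrtq) :
  (z ^+ (2 * a + 2) - w ^+ (2 * l)) * (z ^+ (2 * a) - w ^+ (2 * l + 2)) != 0.
Proof. by rewrite mulf_neq0 // sqrtqV_expB_neq0 // ?addn2 ?addnS. Qed.

(* Main.v *)
(* At z w = 1 every factor of H_lambda is 1, so only the sums of
   1 + (x - 1) (1 - y) phi_lambda(x, y), with x = z^2 and y = w^2, remain. Each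
   row of length m at the top of a partition contributes (1 - y) x^m and
   multiplies the contribution of the rows below by y; so, for partitions with
   parts at most N, removing the largest part gives the generating function
     (sum_(m <= N) (y; T)_m / (T; T)_m (x T)^m) / (y T; T)_N.
   By the q-binomial theorem, proved modulo T^(N+1) through its functional
   equation, this tends to (x y T; T) / ((x T; T) (y T; T)) as N grows. *)
Require Import Defs.
From HB Require Import structures.
From mathcomp Require Import all_boot all_order all_algebra.
From mathcomp Require Import ring.

Set Implicit Arguments.
Unset Strict Implicit.
Unset Printing Implicit Defensive.

Import GRing.Theory.
Local Open Scope ring_scope.

(** * Coefficients, units and congruences of power series *)

Section FpsCoef.
Variable K : fieldType.
Implicit Types (f g h : fps K) (c : K) (n k : nat).

Lemma coef_fpsD f g n : (f + g) n = f n + g n. Proof. by []. Qed.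

Lemma coef_fpsN f n : (- f) n = - f n. Proof. by []. Qed.

Lemma coef_fpsM f g n : (f * g) n = \sum_(i < n.+1) f i * g (n - i)%N.
Proof. by []. Qed.

Lemma coef_fps1 n : (1 : fps K) n = (n == 0%N)%:R.
Proof. by rewrite /=; case: eqP. Qed.

Lemma coef_fps_constM c f n : (fps_const c * f) n = c * f n.
Proof.
rewrite coef_fpsM big_ord_recl [(n - _)%N]subn0 big1 ?addr0 // => i _.
by rewrite mul0r.
Qed.

Lemma fps_constM : {morph @fps_const K : c d / c * d}.
Proof.
by move=> c d; apply: fpsP => n; rewrite coef_fps_constM /= [RHS]fun_if mulr0.
Qed.

Lemma fps_constD : {morph @fps_const K : c d / c + d}.
Proof.
by move=> c d; apply: fpsP => n; rewrite coef_fpsD /=; case: eqP; rewrite ?addr0.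
Qed.

Lemma fps_constN : {morph @fps_const K : c / - c}.
Proof.
by move=> c; apply: fpsP => n; rewrite coef_fpsN /=; case: eqP; rewrite ?oppr0.
Qed.

Lemma fps_const1 : fps_const (1 : K) = 1. Proof. by []. Qed.

Lemma fps_constX n : {morph @fps_const K : c / c ^+ n}.
Proof. by move=> c; elim: n => // n IHn; rewrite !exprS fps_constM IHn. Qed.

Lemma coef_fpsXnM k f n : (fpsX ^+ k * f) n = if (n < k)%N then 0 else f (n - k)%N.
Proof.
elim: k n => [|k IHk] n; first by rewrite mul1r subn0.
rewrite exprS -mulrA coef_fpsM big_ord_recl mul0r add0r.
case: n => [|n]; first by rewrite big_ord0.
rewrite big_ord_recl mul1r [(_ - _)%N]subn1 big1 ?addr0 => [|i _]; last first.
  by rewrite mul0r.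
by rewrite IHk ltnS subSS.
Qed.

Lemma fps_unitrE f : (f \is a GRing.unit) = (f 0%N != 0). Proof. by []. Qed.

Lemma unit_1subXnM f k : (0 < k)%N -> 1 - f * fpsX ^+ k \is a GRing.unit.
Proof.
move=> k_gt0; rewrite fps_unitrE coef_fpsD coef_fpsN coef_fps1.
by rewrite (mulrC f) coef_fpsXnM k_gt0 subr0 oner_neq0.
Qed.

(** Congruence modulo [fpsX ^+ n.+1], the finite stand-in for T-adic limits. *)
Definition fps_eqmod n f g := forall k, (k <= n)%N -> f k = g k.

Lemma fps_eqmod_refl n f : fps_eqmod n f f. Proof. by []. Qed.

Lemma fps_eqmod_sym n f g : fps_eqmod n f g -> fps_eqmod n g f.
Proof. by move=> fg k /fg. Qed.

Lemma fps_eqmod_trans n g f h :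
  fps_eqmod n f g -> fps_eqmod n g h -> fps_eqmod n f h.
Proof. by move=> fg gh k le_kn; rewrite fg ?gh. Qed.

Lemma fps_eqmodMl n h f g : fps_eqmod n f g -> fps_eqmod n (h * f) (h * g).
Proof.
move=> fg k le_kn; rewrite !coef_fpsM; apply: eq_bigr => i _.
by rewrite fg // (leq_trans (leq_subr _ _)).
Qed.

Lemma fps_eqmodMr n h f g : fps_eqmod n f g -> fps_eqmod n (f * h) (g * h).
Proof. by rewrite ![_ * h]mulrC; apply: fps_eqmodMl. Qed.

Lemma fps_eqmodIr n u f g :
  u \is a GRing.unit -> fps_eqmod n (f * u) (g * u) -> fps_eqmod n f g.
Proof. by move=> Uu /(fps_eqmodMr u^-1); rewrite !mulrK. Qed.

Lemma fps_eqmod_addXn n k f h : (n < k)%N -> fps_eqmod n (f + fpsX ^+ k * h) f.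
Proof.
move=> lt_nk i le_in; rewrite coef_fpsD coef_fpsXnM.
by rewrite (leq_ltn_trans le_in lt_nk) addr0.
Qed.

End FpsCoef.

(** * The truncated q-binomial series with base [t] *)

Section QBinomial.
Variables (R : comUnitRingType) (t y : R).
Hypothesis unit_t : forall n, (0 < n)%N -> 1 - t ^+ n \is a GRing.unit.

(** In Pochhammer notation, (y; t)_m / (t; t)_m. *)
Definition qbin_coef m : R := \prod_(j < m) ((1 - y * t ^+ j) / (1 - t ^+ j.+1)).

Definition qbin_sum n z : R := \sum_(m < n.+1) qbin_coef m * z ^+ m.

Lemma qbin_coefS m :
  qbin_coef m.+1 * (1 - t ^+ m.+1) = qbin_coef m * (1 - y * t ^+ m).
Proof. by rewrite /qbin_coef big_ord_recr -mulrA divrK ?unit_t. Qed.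

(** Both sides are (y; t)_(m+1); the factor at exponent 0 is split off so that what is left is a
    product starting at exponent 1, as in the generating functions of partitions. *)
Lemma qbin_coefS_prod m :
  qbin_coef m.+1 * \prod_(1 <= j < m.+2) (1 - t ^+ j) =
  (1 - y) * \prod_(1 <= j < m.+1) (1 - y * t ^+ j).
Proof.
elim: m => [|m IHm].
  rewrite big_nat1 big_geq // mulr1 expr1 -[1 - t]/(1 - t ^+ 1) qbin_coefS.
  by rewrite /qbin_coef big_ord0 mul1r expr0 mulr1.
rewrite big_nat_recr //= [in RHS]big_nat_recr //=.
by rewrite mulrCA qbin_coefS mulrCA !mulrA -IHm mulrAC.
Qed.

(* The functional equation f(z) = (1 - y z) / (1 - z) f(t z) of the q-binomial
   series, with the boundary term due to truncation. *)
Lemma qbin_sum_shift n z :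
  (1 - z) * qbin_sum n z =
  (1 - y * z) * qbin_sum n (z * t) - qbin_coef n * (1 - y * t ^+ n) * z ^+ n.+1.
Proof.
elim: n => [|n IHn].
  by rewrite /qbin_sum !big_ord1 /qbin_coef big_ord0 !expr0 expr1; ring.
rewrite /qbin_sum big_ord_recr [in RHS]big_ord_recr /= -/(qbin_sum n z).
rewrite -/(qbin_sum n (z * t)) [LHS]mulrDr IHn -qbin_coefS exprMn.
rewrite [z ^+ n.+2]exprS [t ^+ n.+1]exprS.
ring.
Qed.

End QBinomial.

(** * The q-binomial theorem modulo T^(n+1) *)

Section QBinomialFps.
Variable K : fieldType.
Implicit Types x y : fps K.

Lemma unit_1subX n : (0 < n)%N -> 1 - (fpsX : fps K) ^+ n \is a GRing.unit.
Proof. by move=> n_gt0; rewrite -[_ ^+ n]mul1r unit_1subXnM. Qed.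

(** The functional equation is iterated at z = x T, ..., x T^k. Each boundary term contains z^(n+1),
    hence T^(n+1), and vanishes in the congruence. *)
Lemma qbin_sum_shiftn n x y k :
  fps_eqmod n
    (\prod_(1 <= j < k.+1) (1 - x * fpsX ^+ j) * qbin_sum fpsX y n (x * fpsX))
    (\prod_(1 <= j < k.+1) (1 - x * y * fpsX ^+ j)
       * qbin_sum fpsX y n (x * fpsX ^+ k.+1)).
Proof.
elim: k => [|k IHk]; first by rewrite !big_geq.
rewrite !(big_nat_recr k.+1) //= mulrAC.
apply: fps_eqmod_trans (fps_eqmodMr _ IHk) _.
rewrite mulrAC -!mulrA; apply: fps_eqmodMl.
have ->  : x * (y * fpsX ^+ k.+1) = y * (x * fpsX ^+ k.+1) by ring.
rewrite (qbin_sum_shift _ unit_1subX) [fpsX ^+ k.+2]exprSr.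
rewrite -[x * fpsX ^+ k.+1 * fpsX]mulrA.
set c := qbin_coef _ _ _ * _.
have -> : (x * fpsX ^+ k.+1) ^+ n.+1 = (x * fpsX ^+ k) ^+ n.+1 * fpsX ^+ n.+1.
  by rewrite [fpsX ^+ k.+1]exprSr mulrA exprMn.
set d := (x * fpsX ^+ k) ^+ n.+1.
have -> : - (c * (d * fpsX ^+ n.+1)) = fpsX ^+ n.+1 * - (c * d).
  by rewrite mulrA mulrC mulrN.
exact: fps_eqmod_addXn.
Qed.

Lemma qbin_sum_Xn n k x y : (n < k)%N ->
  fps_eqmod n (qbin_sum fpsX y n (x * fpsX ^+ k)) 1.
Proof.
move=> lt_nk; rewrite /qbin_sum big_ord_recl /qbin_coef big_ord0 mulr1.
under eq_bigr => i _ do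
  rewrite lift0 exprS [x * _]mulrC -mulrA mulrCA.
by rewrite -mulr_sumr; apply: fps_eqmod_addXn.
Qed.

(** After n shifts the argument is x T^(n+1), where only the constant term 1 of the sum survives. *)
Lemma qbinomial n x y :
  fps_eqmod n
    (\prod_(1 <= j < n.+1) (1 - x * fpsX ^+ j) * qbin_sum fpsX y n (x * fpsX))
    (\prod_(1 <= j < n.+1) (1 - x * y * fpsX ^+ j)).
Proof.
apply: fps_eqmod_trans (qbin_sum_shiftn x y n) _.
rewrite -[X in fps_eqmod n _ X]mulr1; apply: fps_eqmodMl.
exact: qbin_sum_Xn.
Qed.

End QBinomialFps.

(** * Partitions with bounded largest part *)

Section BoundedPartitions.
Variable K : fieldType.
Implicit Types (c : seq nat -> K) (la mu : seq nat) (x y : K).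

(** The head of a partition is its largest part; the default 0 lets the empty partition satisfy
    every bound. *)
Definition bounded_series N c : fps K :=
  Fps (fun n => \sum_(la <- partitions n | (head 0 la <= N)%N) c la).

Lemma is_partition_cons m la :
  is_partition (m :: la) = [&& (0 < m)%N, (head 0 la <= m)%N & is_partition la].
Proof.
rewrite /is_partition inE negb_or eq_sym -lt0n /=.
by case: la => [|k la]; case: (0 < m)%N; rewrite /= ?andbF ?andbT -?andbA.
Qed.

(** If the largest part is exactly N+1, removing it leaves an arbitrary partition with parts at most
    N+1, of size smaller by N+1. *)
Lemma bounded_seriesS N c :
  bounded_series N.+1 c = bounded_series N c +
    fpsX ^+ N.+1 * bounded_series N.+1 (fun la => c (N.+1 :: la)).
Proof.
apply: fpsP => n; rewrite coef_fpsD coef_fpsXnM.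
rewrite [LHS](bigID (fun la => (head 0 la <= N)%N)) /=; congr (_ + _).
  apply: eq_bigl => la.
  by rewrite andb_idl // => /leq_trans; apply.
have headS la : (head 0 la <= N.+1)%N && ~~ (head 0 la <= N)%N =
    (head 0 la == N.+1)%N by rewrite -ltnNge eqn_leq.
under eq_bigl do rewrite headS.
rewrite -big_filter; case: ltnP => [lt_nN | le_Nn].
  rewrite big1_seq // => la /=.
  rewrite mem_filter mem_partitions => /and3P[/eqP hd_la _ /eqP sum_la].
  case: la hd_la sum_la => [|m la] //= -> sum_la.
  by rewrite -sum_la ltnNge leq_addr in lt_nN.
(* Prepending the part N+1 is the bijection that reindexes the sum. *)
rewrite -[RHS]big_filter -(big_map (cons N.+1) predT c); apply: perm_big.
apply: uniq_perm; first by rewrite filter_uniq ?partitions_uniq.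
  rewrite map_inj_uniq => [|la mu []//].
  exact: filter_uniq (partitions_uniq _).
move=> la; rewrite mem_filter mem_partitions.
apply/idP/mapP => [/and3P[hd_la part_la sum_la] | [mu mu_in ->]].
  case: la hd_la part_la sum_la => [|m la] //= /eqP->.
  rewrite is_partition_cons => /and3P[_ hd_la part_la] /eqP sum_la.
  exists la => //; rewrite mem_filter mem_partitions hd_la part_la /=.
  by rewrite -sum_la addKn.
move: mu_in; rewrite mem_filter mem_partitions /= => /and3P[hd_mu part_mu /eqP->].
by rewrite is_partition_cons hd_mu part_mu subnKC ?eqxx.
Qed.

Lemma bounded_series0 c : bounded_series 0 c = fps_const (c [::]).
Proof.
apply: fpsP => n /=; rewrite -big_filter.
have -> : [seq la <- partitions n | (head 0 la <= 0)%N] =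
    if n == 0%N then [:: [::]] else [::].
  apply: perm_small_eq; first by case: eqP.
  apply: uniq_perm; first by rewrite filter_uniq ?partitions_uniq.
    by case: eqP.
  move=> la; rewrite mem_filter mem_partitions.
  case: la => [|m la]; first by rewrite /= eq_sym; case: eqP.
  by rewrite is_partition_cons /= lt0n; case: (m); case: (n).
by case: eqP => _; rewrite ?big_seq1 ?big_nil.
Qed.

Lemma bounded_seriesE N c : fps_eqmod N (partition_series c) (bounded_series N c).
Proof.
move=> n le_nN /=; rewrite [RHS]big_mkcond; apply: eq_big_seq => la.
rewrite mem_partitions => /andP[_ /eqP sum_la].
rewrite (leq_trans _ le_nN) // -sum_la.
by case: la {sum_la} => //= m la; apply: leq_addr.
Qed.

Lemma bounded_seriesD N c1 c2 :
  bounded_series N (fun la => c1 la + c2 la) =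
  bounded_series N c1 + bounded_series N c2.
Proof. by apply: fpsP => n /=; rewrite -big_split. Qed.

Lemma bounded_seriesZ N a c :
  bounded_series N (fun la => a * c la) = fps_const a * bounded_series N c.
Proof. by apply: fpsP => n; rewrite coef_fps_constM /= mulr_sumr. Qed.

(** For constant weights the recursion reads (1 - T^(N+1)) B_(N+1) = B_N, so the product
    telescopes. *)
Lemma bounded_series_cst1 N :
  \prod_(1 <= j < N.+1) (1 - fpsX ^+ j) * bounded_series N (fun=> 1) = 1.
Proof.
elim: N => [|N IHN]; first by rewrite big_geq // mul1r bounded_series0.
rewrite big_nat_recr //= -mulrA mulrBl mul1r.
by rewrite [X in X - _]bounded_seriesS addrK.
Qed.

(* When x y = 1 this is the sum of x^(j - i) over the addable boxes (i, j) of
   the partition minus the same sum over its removable ones. *)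
Definition corner_sum x y la : K := 1 + (x - 1) * (1 - y) * phi x y la.

(** The new top row adds a geometric sum, which x - 1 turns into x^m - 1; the older rows move down
    by one, whence the factor y. *)
Lemma corner_sum_cons x y m la :
  corner_sum x y (m :: la) = y * corner_sum x y la + (1 - y) * x ^+ m.
Proof.
have phi_cons : phi x y (m :: la) = \sum_(j < m) x ^+ j + y * phi x y la.
  rewrite /phi /= big_ord_recl /=; congr (_ + _).
    by apply: eq_bigr => j _; rewrite mulr1.
  rewrite mulr_sumr; apply: eq_bigr => i _; rewrite mulr_sumr.
  by apply: eq_bigr => j _; rewrite [bump 0 i]add1n exprS mulrCA.
rewrite /corner_sum phi_cons mulrDr mulrAC -subrX1.
ring.
Qed.

Lemma bounded_series_corner_sum N x y :
  \prod_(1 <= j < N.+1) (1 - fps_const y * fpsX ^+ j) *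
    bounded_series N (corner_sum x y) =
  qbin_sum fpsX (fps_const y) N (fps_const x * fpsX).
Proof.
elim: N => [|N IHN].
  rewrite big_geq // mul1r bounded_series0 /qbin_sum big_ord1 /qbin_coef big_ord0.
  by rewrite /corner_sum /phi big_ord0 mulr0 addr0 mul1r.
rewrite big_nat_recr //= /qbin_sum big_ord_recr /= -/(qbin_sum _ _ N _) -IHN.
(* The y-multiple of the series produced by [corner_sum_cons] moves to the left and yields the
   factor 1 - y T^(N+1). *)
have rec : (1 - fps_const y * fpsX ^+ N.+1) * bounded_series N.+1 (corner_sum x y)
    = bounded_series N (corner_sum x y) +
      fpsX ^+ N.+1 * (fps_const ((1 - y) * x ^+ N.+1) * bounded_series N.+1 (fun=> 1)).
  rewrite mulrBl mul1r [X in X - _]bounded_seriesS.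
  have -> : bounded_series N.+1 (fun la => corner_sum x y (N.+1 :: la)) =
      fps_const y * bounded_series N.+1 (corner_sum x y) +
      fps_const ((1 - y) * x ^+ N.+1) * bounded_series N.+1 (fun=> 1).
    rewrite -!bounded_seriesZ -bounded_seriesD; congr (bounded_series _ _).
    by apply/boolp.funext => la; rewrite mulr1 corner_sum_cons.
  by ring.
rewrite -mulrA rec mulrDr; congr (_ + _).
(* The series of constant weights is 1 / (T; T)_(N+1), so the remaining term is the last summand of
   the q-binomial sum. *)
have -> : qbin_coef fpsX (fps_const y) N.+1 =
    (1 - fps_const y) * \prod_(1 <= j < N.+1) (1 - fps_const y * fpsX ^+ j) *
    bounded_series N.+1 (fun=> 1).
  rewrite -(qbin_coefS_prod _ (unit_1subX K)) -mulrA.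
  by rewrite bounded_series_cst1 mulr1.
rewrite exprMn fps_constM fps_constX fps_constD fps_constN fps_const1.
by ring.
Qed.

End BoundedPartitions.

(** * Passing to all partitions, and the specialization *)

Section Main.
Variable K : fieldType.
Implicit Types x y z w : K.

Lemma prod_1subXn (f : nat -> fps K) N :
  \prod_(1 <= j < N.+1) (1 - f j * fpsX ^+ j) \is a GRing.unit.
Proof.
rewrite big_seq; apply: rpred_prod => j; rewrite mem_index_iota => /andP[j_gt0 _].
exact: unit_1subXnM.
Qed.

Lemma partition_series_cst1_eqmod N :
  fps_eqmod N
    (\prod_(1 <= j < N.+1) (1 - fpsX ^+ j) * partition_series (fun=> 1 : K)) 1.
Proof.
rewrite -[X in fps_eqmod N _ X](bounded_series_cst1 K N).
apply: fps_eqmodMl.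
exact: bounded_seriesE.
Qed.

Lemma partition_series_corner_sum_eqmod N x y :
  fps_eqmod N
    (\prod_(1 <= j < N.+1) (1 - fps_const x * fpsX ^+ j) *
     (\prod_(1 <= j < N.+1) (1 - fps_const y * fpsX ^+ j) *
      partition_series (corner_sum x y)))
    (\prod_(1 <= j < N.+1) (1 - fps_const (x * y) * fpsX ^+ j)).
Proof.
apply: fps_eqmod_trans.
  by do 2!apply: fps_eqmodMl; apply: bounded_seriesE.
by rewrite bounded_series_corner_sum fps_constM; apply: qbinomial.
Qed.

(** In each factor, numerator minus denominator is z^(2a) w^(2l) (1 - z w)^2. *)
Lemma Hook_mul1 z w la : z * w = 1 ->
  (forall a l, (z ^+ (2 * a + 2) - w ^+ (2 * l)) *
               (z ^+ (2 * a) - w ^+ (2 * l + 2)) != 0) ->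
  Hook z w la = 1.
Proof.
move=> zw1 den_neq0; rewrite /Hook big1 // => i _; rewrite big1 // => j _.
rewrite /hook_term; move: (arm _ _ _) (leg _ _ _) => a l.
apply: (canLR (mulfK (den_neq0 a l))); rewrite mul1r.
rewrite !(exprD _ (2 * a)) !(exprD _ (2 * l)) !expr1.
move: (z ^+ (2 * a)) (w ^+ (2 * l)) => Z W.
apply/eqP; rewrite -subr_eq0; apply/eqP.
transitivity (Z * W * (1 - z * w) ^+ 2); first by ring.
by rewrite zw1 subrr expr0n mulr0.
Qed.

End Main.

Theorem theorem4p3 :
  let z : Qsqrtq := sqrtq^-1 in
  let w : Qsqrtq := sqrtq in
  fps_is_prod
    (fun n : nat =>
      (1 - fps_const (z * w) * fpsX ^+ n) ^+ 2 /
      ((1 - fps_const (z ^+ 2) * fpsX ^+ n) * (1 - fps_const (w ^+ 2) * fpsX ^+ n)))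
    (1 + fps_const ((z ^+ 2 - 1) * (1 - w ^+ 2)) *
      (partition_series (fun la => Hook z w la * phi (z ^+ 2) (w ^+ 2) la) /
       partition_series (fun la => Hook z w la))).
Proof.
(* The partial product up to n is already correct modulo T^(n+1), so the index of the coefficient
   serves as threshold. *)
move=> z w N; exists N => n le_Nn.
have zw1 : z * w = 1 by rewrite mulVf ?sqrtq_neq0.
have unitP := partition_series_Hook_unit z w.
have Hook1 : Hook z w = fun=> 1.
  apply/boolp.funext => la; apply: Hook_mul1 zw1 _ => a l.
  exact: hook_denominator_neq0.
move: unitP; rewrite Hook1; set P := partition_series _ => unitP.
set x := z ^+ 2; set y := w ^+ 2; set c := (x - 1) * (1 - y).
have xy1 : x * y = 1 by rewrite -exprMn zw1 expr1n.
have -> : 1 + fps_const c * (partition_series (fun la => 1 * phi x y la) / P) =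
    partition_series (corner_sum x y) / P.
  rewrite -{1}(divrr unitP) mulrA -mulrDl; congr (_ / _).
  apply: fpsP => k; rewrite coef_fpsD coef_fps_constM /= mulr_sumr -big_split.
  by apply: eq_bigr => la _; rewrite mul1r.
suff : fps_eqmod n
    (\prod_(1 <= j < n.+1) ((1 - fps_const (z * w) * fpsX ^+ j) ^+ 2 /
      ((1 - fps_const x * fpsX ^+ j) * (1 - fps_const y * fpsX ^+ j))))
    (partition_series (corner_sum x y) / P) by apply.
set E := \prod_(1 <= j < n.+1) (1 - fpsX ^+ j) : fps Qsqrtq.
pose C a := \prod_(1 <= j < n.+1) (1 - fps_const a * fpsX ^+ j) : fps Qsqrtq.
(* Denominators are cleared; both sides are then congruent to [E]. *)
apply: (@fps_eqmodIr _ _ (C x * C y * P)).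
  by rewrite !unitrM unitP /C !prod_1subXn.
apply: (@fps_eqmod_trans _ _ E).
  (* As z w = 1, the numerators multiply to [E] squared, and [E * P] is congruent to 1. *)
  have -> : \prod_(1 <= j < n.+1) ((1 - fps_const (z * w) * fpsX ^+ j) ^+ 2 /
      ((1 - fps_const x * fpsX ^+ j) * (1 - fps_const y * fpsX ^+ j))) *
      (C x * C y * P) = E * (E * P).
    rewrite ![_ * (_ * P)]mulrA; congr (_ * _); rewrite -!big_split.
    apply: eq_big_nat => j /andP[j_gt0 _] /=.
    rewrite divrK; last by rewrite unitrM !unit_1subXnM.
    by rewrite zw1 fps_const1 mul1r.
  rewrite -[X in fps_eqmod _ _ X]mulr1; apply: fps_eqmodMl.
  exact: partition_series_cst1_eqmod.
(* On the other side [P] cancels, and x y = 1 turns the right-hand side of the q-binomial theorem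
   into [E]. *)
apply: fps_eqmod_sym; rewrite [C x * C y * P]mulrC mulrA divrK // mulrC -mulrA.
apply: fps_eqmod_trans (partition_series_corner_sum_eqmod x y) _.
rewrite xy1 fps_const1; under eq_bigr do rewrite mul1r.
exact: fps_eqmod_refl.
Qed.
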